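(* Let $r,h,g$ be positive integers with $r\ge h+2$ and $g+h<gr$, and put $n=rg$. Then there exists an MR $(n,r,h,1)$-LRC over a field of size \[\ell\le\left(\max\left\{\tilde O\!\left(\tfrac nr\right),\ (2r)^{\lfloor\frac{h+1}{2}\rfloor}\right\}\right)^{\min\{h,\frac nr\}}.\]
   Context: $\tilde O(f)$ denotes $f\cdot(\log f)^{O(1)}$. Definition: let $\ell$ be a prime power, $a,g,r,h$ positive integers with $ga+h<gr$, $n=gr$, $k=n-ga-h$. An MR (maximally recoverable) $(n,r,h,a)_\ell$-LRC is an $[n,k]$ linear code over $\mathbb{F}_\ell$ with a parity-check matrix $H$ of the block form whose first $ga$ rows are block diagonal with diagonal blocks $A_1,\dots,A_g$ (each $a\times r$, coordinates split into $g$ consecutive groups of size $r$) and whose last $h$ rows are $(D_1|\cdots|D_g)$ with each $D_i$ of size $h\times r$, such that (i) each $A_i$ generates an $[r,a,r-a+1]_\ell$ MDS code, and (ii) every set of $ag+h$ columns of $H$ consisting of any $a$ columns from each group together with any $h$ further columns is linearly independent over $\mathbb{F}_\ell$. ''Over a field of size $\ell$'' means an MR $(n,r,h,a)_\ell$-LRC. *)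

(* Defs.v *)
From HB Require Import structures.
From mathcomp Require Import all_boot all_order all_algebra.
Set Implicit Arguments. Unset Strict Implicit. Unset Printing Implicit Defensive.
Import GRing.Theory.
Local Open Scope ring_scope.

Definition generates_MDS (F : fieldType) (a r : nat) (A : 'M[F]_(a, r)) : Prop :=
  \rank A = a /\
  forall v : 'rV[F]_r, (v <= A)%MS -> v != 0 ->
    (r - a + 1 <= #|[set j : 'I_r | v ord0 j != 0%R]|)%N.

Definition LRC_pcm (F : fieldType) (g r h a : nat)
  (A : 'I_g -> 'M[F]_(a, r)) (D : 'I_g -> 'M[F]_(h, r)) :
  'M[F]_((\sum_(i < g) a)%N + h, (\sum_(i < g) r)%N) :=
  col_mx (\mxblock_(i < g, j < g) (if i == j then A i else 0)) (\mxrow_(i < g) D i).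

Definition col_group (g r : nat) (c : 'I_(\sum_(i < g) r)) : 'I_g := tagnat.sig1 c.

Definition cols_independent (F : fieldType) (m n : nat) (M : 'M[F]_(m, n))
  (S : {set 'I_n}) : Prop :=
  forall x : 'cV[F]_n, (forall c, c \notin S -> x c ord0 = 0%R) -> M *m x = 0 -> x = 0.

(* H (given by blocks A, D) is the parity-check matrix of an MR (n,r,h,a)-LRC,
   n = g r, k = n - g a - h.  The rank condition says H has full row rank,
   so the code ker H is an [n, n - ga - h] code. *)
Definition MR_LRC (F : fieldType) (g r h a : nat)
  (A : 'I_g -> 'M[F]_(a, r)) (D : 'I_g -> 'M[F]_(h, r)) : Prop :=
  (0 < a)%N /\ (0 < g)%N /\ (0 < r)%N /\ (0 < h)%N /\ (g * a + h < g * r)%N /\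
  \rank (LRC_pcm A D) = (g * a + h)%N /\
  (forall i, generates_MDS (A i)) /\
  (forall S : {set 'I_(\sum_(i < g) r)},
     #|S| = (g * a + h)%N ->
     (forall i : 'I_g, (a <= #|[set c in S | col_group c == i]|)%N) ->
     cols_independent (LRC_pcm A D) S).

Definition exists_MR_LRC (l g r h a : nat) : Prop :=
  exists (F : finFieldType), #|F| = l /\
    exists (A : 'I_g -> 'M[F]_(a, r)) (D : 'I_g -> 'M[F]_(h, r)), MR_LRC A D.

(* Main.v *)
(* Take all local parity checks equal to the all-ones row, so that the code is given by
   points x_{i,j} of F^h, and use linearized Reed-Solomon codes.  Let q be the least power
   of 2 with q >= max(g+1, r), let F have q^h elements and let w be a primitive element of
   F.  The elements w^i, i < g, lie in distinct classes for the twisted conjugation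
   c -> c x^(q-1), hence a nonzero skew polynomial of degree < h has kernels over these g
   classes of total dimension < h over F_q.  Choose x_{i,j} as the vector of the first h
   iterates of x -> w^i x^q at a point beta_j, where the beta_j lie on a moment curve in
   F = F_q^h, so that any h + 1 of them are affinely independent over F_q.  A functional
   that is constant on the selected points of each group vanishes at h independent
   differences, so it is zero.
   The size q^h is within the bound, by distinguishing h <= g (where q itself is at most the
   maximum) and 2 <= g < h (where q < 2r).  For g = 1 the ordinary moment curve over
   F_q is used instead. *)
Require Import Defs.
From HB Require Import structures.
From mathcomp Require Import all_boot all_order all_algebra.
From mathcomp Require Import all_solvable all_field.
From mathcomp Require Import zify ring.
Set Implicit Arguments. Unset Strict Implicit. Unset Printing Implicit Defensive.
Import GRing.Theory.
Local Open Scope ring_scope.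

(** * Reduction to a trivial left kernel *)

Section Duality.
Variables (F : fieldType) (g r h : nat).

Lemma mul_row_LRC_pcm a (A : 'I_g -> 'M[F]_(a, r)) (D : 'I_g -> 'M[F]_(h, r))
    (u : 'rV[F]_((\sum_(i < g) a)%N + h)) (c : 'I_(\sum_(i < g) r)) :
  (u *m LRC_pcm A D) ord0 c
  = (submxrow (lsubmx u) (tagnat.sig1 c) *m A (tagnat.sig1 c)) ord0 (tagnat.sig2 c)
    + (rsubmx u *m D (tagnat.sig1 c)) ord0 (tagnat.sig2 c).
Proof.
rewrite -{1}(hsubmxK u) /LRC_pcm mul_row_col mul_mxrow -{1}(submxrowK (lsubmx u)).
rewrite mul_mxrow_mxblock !mxE; congr (_ + _).
rewrite (bigD1 (tagnat.sig1 c)) //= eqxx [X in _ + X]big1 => [|i ne_i].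
  by rewrite addr0 mxE.
by rewrite (negPf ne_i) mulmx0.
Qed.

Lemma generates_MDS_const1 : (0 < r)%N ->
  generates_MDS (const_mx 1 : 'M[F]_(1, r)).
Proof.
case: r => // r' _; split=> [|v /submxP[b ->] nz].
  apply/eqP; rewrite rank_rV; suff ->: const_mx 1 != 0 :> 'M[F]_(1, r'.+1) by [].
  by apply/eqP=> /matrixP/(_ ord0 ord0); rewrite !mxE => /eqP; rewrite oner_eq0.
have Eb j : (b *m const_mx 1 : 'rV[F]_r'.+1) ord0 j = b ord0 ord0.
  by rewrite !mxE big_ord1 !mxE mulr1.
rewrite subn1 addn1 /= -[X in (X <= _)%N]card_ord -cardsT; apply: subset_leq_card.
apply/subsetP=> j _; rewrite inE Eb; apply: contraNneq nz => b0.
by apply/eqP/rowP=> k; rewrite Eb b0 mxE.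
Qed.

(* A square matrix has independent columns iff its left kernel is trivial; a left
   kernel vector [(c, y)] has one entry [c i] per group and a part [y] shared
   by all groups. *)
Lemma MR_LRC_const1 (D : 'I_g -> 'M[F]_(h, r)) :
    (0 < g)%N -> (0 < h)%N -> (h + 2 <= r)%N -> (g + h < g * r)%N ->
    (forall (S : 'I_g -> {set 'I_r}) (c : 'I_g -> F) (y : 'rV[F]_h),
       (forall i, 0 < #|S i|)%N -> (\sum_i #|S i| = g + h)%N ->
       (forall i j, j \in S i -> c i + (y *m D i) ord0 j = 0) -> y = 0) ->
  MR_LRC (fun=> const_mx 1 : 'M[F]_(1, r)) D.
Proof.
move=> g0 h0 hr ltgr ker0; set A := fun=> _.
have r0 : (0 < r)%N by apply: leq_trans hr; rewrite addn2.
(* The hypothesis kills only the shared part of [u]; each group's own entry then vanishes because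
   some column of that group is selected. *)
have left0 (T : 'I_g -> {set 'I_r}) (u : 'rV[F]_((\sum_(i < g) 1)%N + h)) :
    (forall i, 0 < #|T i|)%N -> (\sum_i #|T i| = g + h)%N ->
    (forall c, tagnat.sig2 c \in T (tagnat.sig1 c) -> (u *m LRC_pcm A D) ord0 c = 0) ->
  u = 0.
  move=> T0 sT uH.
  have {uH} uT i j : j \in T i ->
      submxrow (lsubmx u) i ord0 ord0 + (rsubmx u *m D i) ord0 j = 0.
    move=> Tj; have := uH (tagnat.Rank i j); rewrite mul_row_LRC_pcm.
    have -> : tagnat.sig1 (tagnat.Rank i j) = i by exact: tagnat.Rank1K.
    have -> : tagnat.sig2 (tagnat.Rank i j) = j.
      by rewrite tagnat.Rank2K; apply: val_inj.
    by move=> /(_ Tj); rewrite {1}mxE big_ord1 [const_mx _ _ _]mxE mulr1.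
  have y0 := ker0 T _ _ T0 sT uT.
  rewrite -(hsubmxK u) y0 -(submxrowK (lsubmx u)).
  apply/rowP=> k; rewrite [RHS]mxE; case: (split_ordP k) => {}k ->.
    rewrite row_mxEl mxE; move: (tagnat.sig2 k) => z; rewrite (ord1 z) {z}.
    move: (tagnat.sig1 k) => i; have /card_gt0P[j Tj] := T0 i.
    by have := uT _ _ Tj; rewrite y0 mul0mx [X in _ + X]mxE addr0.
  by rewrite row_mxEr mxE.
split=> //; split=> //; split=> //; split=> //.
split; first by rewrite muln1.
split.
  have -> : (g * 1 + h)%N = ((\sum_(i < g) 1)%N + h)%N.
    by rewrite sum_nat_const card_ord.
  apply/eqP; apply: inj_row_free => u uH.
  have hr1 : (h.+1 <= r)%N by apply: leq_trans hr; rewrite addn2.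
  (* A test selection for the rank: [h + 1] columns of the first group and one of every other
     group. *)
  pose T (i : 'I_g) := [set j : 'I_r | j < (if val i == 0 then h.+1 else 1)]%N.
  have cT (m : nat) : (m <= r)%N -> #|[set j : 'I_r | (j < m)%N]| = m.
    move=> mr; rewrite -sum1_card (eq_bigl (fun j : 'I_r => j < m)%N) => [|j]; last by rewrite inE.
    by rewrite -(big_ord_widen r (fun=> 1%N)) // sum1_card card_ord.
  apply: (left0 T).
  - by move=> i; rewrite cT; case: ifP.
  - rewrite (bigD1 (Ordinal g0)) //= cT // (eq_bigr (fun=> 1%N)) => [|i ni].
      rewrite sum_nat_const muln1 cardC1 card_ord addSnnS prednK //.
      by rewrite addnC.
    rewrite cT; have /negPf-> // : val i != 0 by apply: contraNneq ni => i0; apply/eqP/val_inj.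
  by move=> c _; rewrite uH mxE.
split=> [i|S cS Sg]; first exact: generates_MDS_const1.
pose T (i : 'I_g) := [set j : 'I_r | tagnat.Rank i j \in S].
have cardT (i : 'I_g) : #|T i| = #|[set c in S | col_group c == i]|.
  rewrite -(card_imset (mem (T i)) (f := tagnat.Rank i)); last first.
    move=> j k /(congr1 val)/eqP; rewrite tagnat.eq_Rank eqxx /= => /eqP; exact: val_inj.
  apply: eq_card => c; apply/imsetP/idP => [[j]|].
    rewrite inE => Sj ->; rewrite inE Sj /col_group; apply/eqP; exact: tagnat.Rank1K.
  rewrite inE => /andP[Sc /eqP <-]; exists (tagnat.sig2 c).
    by rewrite inE tagnat.sig2K.
  by rewrite tagnat.sig2K.
have sumT : (\sum_i #|T i| = g + h)%N.
  have -> : (g + h = #|S|)%N by rewrite cS muln1.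
  rewrite (eq_bigr _ (fun i _ => cardT i)) -[RHS]sum1_card.
  rewrite (partition_big (@col_group g r) predT) //=; apply: eq_bigr => i _.
  by rewrite -sum1_card; apply: eq_bigl => c; rewrite inE.
pose f (k : 'I_#|S|) := enum_val k.
(* There are as many selected columns as rows, so a trivial left kernel gives a trivial right
   kernel. *)
have freeH : row_free (colsub f (LRC_pcm A D)).
  apply: inj_row_free => u uH; apply: (left0 T) => //.
    by move=> i; rewrite cardT Sg.
  move=> c; rewrite inE tagnat.sig2K => Sc.
  have /matrixP/(_ ord0 (enum_rank_in Sc c)) := uH.
  by rewrite mulmx_colsub [in X in X -> _]mxE /f enum_rankK_in // => ->; rewrite mxE.
have full : row_full (colsub f (LRC_pcm A D)).
  by rewrite /row_full (eqP freeH) cS sum_nat_const card_ord.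
move=> x x0 Hx.
suff xf : rowsub f x = 0.
  apply/colP=> c; rewrite [RHS]mxE; case: (boolP (c \in S)) => [Sc|/x0 //].
  by have /colP/(_ (enum_rank_in Sc c)) := xf; rewrite !mxE /f enum_rankK_in.
apply: (row_full_inj full); rewrite mulmx0; apply/colP=> k; rewrite [RHS]mxE.
have /colP/(_ k) := Hx; rewrite [in X in X -> _]mxE [X in _ = X -> _]mxE => Hk.
rewrite mxE -[RHS]Hk [RHS](bigID (fun c => c \in S)) /= [X in _ + X]big1 ?addr0; last first.
  by move=> c /x0->; rewrite mulr0.
by rewrite [RHS]big_enum_val; apply: eq_bigr => c _; rewrite !mxE.
Qed.

End Duality.

(** * Roots of skew polynomials *)

Lemma leq_card_fibres (T U : finType) (f : T -> U) (A : {set T}) m :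
  (forall y, #|[set x in A | f x == y]| <= m)%N -> (#|A| <= m * #|f @: A|)%N.
Proof.
move=> fib; rewrite -sum1_card (partition_big_imset f) /= mulnC -sum_nat_const.
apply: leq_sum => y _; apply: leq_trans (fib y); rewrite -sum1_card.
by under [X in (_ <= X)%N]eq_bigl => x do rewrite inE.
Qed.

Section SkewPolynomials.
Variables (F : finFieldType) (q : nat).
Hypothesis q_gt1 : (1 < q)%N.
Hypothesis frobD : forall x y : F, (x + y) ^+ q = x ^+ q + y ^+ q.

Definition twist (c x : F) := c * x ^+ q.

(* The value at [x] of the skew polynomial \sum_(k < n) a_k t^k, with [t] acting as
   [twist c] *)
Definition skew_eval (c : F) n (a : nat -> F) (x : F) :=
  \sum_(k < n) a k * iter k (twist c) x.

Lemma twistB c x y : twist c (x - y) = twist c x - twist c y.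
Proof.
by apply/eqP; rewrite -subr_eq opprK /twist -mulrDr -frobD subrK.
Qed.

Lemma iter_twistB c k x y :
  iter k (twist c) (x - y) = iter k (twist c) x - iter k (twist c) y.
Proof. by elim: k => //= k ->; rewrite twistB. Qed.

Lemma iter_twistM c k d x :
  iter k (twist c) (d * x) = d ^+ (q ^ k) * iter k (twist c) x.
Proof.
elim: k => [|k /= ->]; first by rewrite expn0 expr1.
by rewrite /twist exprMn -exprM expnSr; ring.
Qed.

Lemma iter_twist0 c k : iter k (twist c) 0 = 0.
Proof. by have := iter_twistB c k 0 0; rewrite !subrr. Qed.

Lemma skew_evalB c n a x y :
  skew_eval c n a (x - y) = skew_eval c n a x - skew_eval c n a y.
Proof.
by rewrite -sumrB; apply: eq_bigr => k _; rewrite iter_twistB mulrBr.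
Qed.

Lemma skew_eval0 c n a : skew_eval c n a 0 = 0.
Proof. by apply: big1 => k _; rewrite iter_twist0 mulr0. Qed.

Lemma skew_evalS c n a x :
  skew_eval c n.+1 a x = skew_eval c n a x + a n * iter n (twist c) x.
Proof. by rewrite /skew_eval big_ord_recr. Qed.

Lemma eq_skew_eval c n a b x :
  (forall k, (k < n)%N -> a k = b k) -> skew_eval c n a x = skew_eval c n b x.
Proof. by move=> ab; apply: eq_bigr => k _; rewrite ab. Qed.

(* Right division by [t - d] *)
Lemma skew_div n a d : exists b e, (forall c x,
    skew_eval c n.+1 a x = skew_eval c n b (twist c x - d * x) + e * x)
  /\ ((0 < n)%N -> b n.-1 = a n).
Proof.
elim: n a => [|n IHn] a.
  exists a, (a 0); split=> // c x.
  by rewrite /skew_eval big_ord1 big_ord0 add0r.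
(* Write a_(n+1) t^(n+1) as a_(n+1) t^n (t - d) + a_(n+1) d^(q^n) t^n; the last term is added to
   coefficient [n] before recursing. *)
have [b [e [Eb _]]] := IHn (fun k => if k == n then a n + a n.+1 * d ^+ (q ^ n) else a k).
exists (fun k => if k == n then a n.+1 else b k), e; split=> [c x|_]; last by rewrite eqxx.
rewrite 2!skew_evalS [in RHS]skew_evalS /= eqxx; have := Eb c x.
rewrite skew_evalS eqxx (@eq_skew_eval _ _ _ a) => [H|k /ltn_eqF->//].
rewrite [in RHS](@eq_skew_eval _ _ _ b) => [|k /ltn_eqF->//].
rewrite iter_twistB iter_twistM -iterSr -[LHS]addrA [X in _ = X]addrAC -H /=; ring.
Qed.

(** The fibre lies among the roots of c X^q - d X - y, of degree exactly [q]. *)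
Lemma card_fibre_twist (c d y : F) : c != 0 ->
  (#|[set x | (twist c x - d * x)%R == y]| <= q)%N.
Proof.
move=> c0; pose p := c *: 'X^q - (d *: 'X + y%:P).
have szp : size p = q.+1.
  rewrite size_polyDl size_scale ?size_polyXn // size_polyN ltnS.
  apply: leq_trans q_gt1; apply: leq_trans (size_polyD _ _) _.
  rewrite geq_max (leq_trans (size_scale_leq _ _)) ?size_polyX //.
  by rewrite (leq_trans (size_polyC_leq1 _)).
rewrite cardE -ltnS -szp; apply: max_poly_roots.
- by rewrite -size_poly_eq0 szp.
- apply/allP=> x; rewrite mem_enum inE rootE !hornerE /twist => /eqP <-.
  by rewrite opprD addrA subrr.
- exact: enum_uniq.
Qed.

Variables (g : nat) (c : 'I_g -> F).
Hypothesis c_neq0 : forall i, c i != 0.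
Hypothesis c_nonconj : forall i j (x : F), x != 0 -> c i * x ^+ q.-1 = c j -> i = j.

Let ker n a i := [set x | skew_eval (c i) n a x == 0].

(* A skew polynomial of degree [n] has at most [n] independent roots over
   all conjugacy classes together; [q] to the dimension is a cardinal here.  A nonzero
   root in class [i0] splits off a factor [t - d], whose kernel has at most [q] elements in
   class [i0] and is trivial in the other classes. *)
Lemma prod_card_ker n (a : nat -> F) : a n != 0 -> (\prod_i #|ker n.+1 a i| <= q ^ n)%N.
Proof.
elim: n a => [|n IHn] a an0.
  rewrite big1 // => i _; apply/eqP/cards1P; exists 0; apply/setP=> x.
  by rewrite !inE /skew_eval big_ord1 mulf_eq0 (negPf an0).
case: (pickP [pred u : 'I_g * F | (u.2 != 0) && (u.2 \in ker n.+2 a u.1)])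
  => [[i0 z]|triv]; last first.
  rewrite big1 ?expn_gt0 ?(ltnW q_gt1) // => i _; apply/eqP/cards1P; exists 0; apply/setP=> x.
  rewrite inE; apply/idP/idP=> [|/eqP->]; last by rewrite inE skew_eval0.
  by apply: contraLR => x0; have /= := triv (i, x); rewrite x0 /= => ->.
rewrite /= inE => /andP[z0 /eqP az].
(* With this [d], t - d annihilates [z] in class [i0], which forces the remainder [e] to be 0. *)
pose d := twist (c i0) z / z.
have [b [e [Eb /(_ isT) /= bn]]] := skew_div n.+1 a d.
have dz : twist (c i0) z - d * z = 0 by rewrite /d divfK ?subrr.
have {az} e0 : e = 0.
  by move/eqP: az; rewrite Eb dz skew_eval0 add0r mulf_eq0 (negPf z0) orbF => /eqP.
have sub i : [set twist (c i) x - d * x | x in ker n.+2 a i] \subset ker n.+1 b i.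
  apply/subsetP=> _ /imsetP[x + ->]; rewrite !inE Eb e0 mul0r addr0 //.
have sz i : (#|ker n.+2 a i| <= (if i == i0 then q else 1) * #|ker n.+1 b i|)%N.
  apply: (@leq_trans ((if i == i0 then q else 1) *
      #|[set (twist (c i) x - d * x)%R | x in ker n.+2 a i]|)%N); last first.
    by rewrite leq_mul2l subset_leq_card ?orbT.
  apply: leq_card_fibres => y; case: eqP => [_|ni].
    apply: leq_trans (card_fibre_twist d y (c_neq0 i)); apply: subset_leq_card.
    by apply/subsetP=> x; rewrite !inE => /andP[].
  (* Two distinct points of one fibre would give [c i * (x - x') ^+ q.-1 = d = c i0 * z ^+ q.-1], so
     [c i] and [c i0] would be conjugate. *)
  apply/card_le1_eqP=> x' x; rewrite !inE => /andP[_ Ex'] /andP[_ Ex].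
  apply/eqP; rewrite -subr_eq0; apply: contra_notT ni => xx0.
  have q0 : q = q.-1.+1 by rewrite prednK // ltnW.
  have : twist (c i) (x - x') = d * (x - x').
    move: Ex Ex'; rewrite twistB !subr_eq => /eqP-> /eqP->; ring.
  rewrite {1}/twist q0 exprSr mulrA => H; have {H} := mulIf xx0 H.
  rewrite /d /twist q0 exprSr mulrA mulfK // => E.
  apply: (c_nonconj (x := (x - x') / z)); first by rewrite mulf_neq0 ?invr_neq0.
  by rewrite exprMn exprVn mulrA E mulfK // expf_neq0.
apply: leq_trans (leq_prod (fun i _ => sz i)) _.
rewrite big_split /= expnS leq_mul ?IHn ?bn //.
rewrite (bigD1 i0) //= eqxx big1 ?muln1 // => i /negPf-> //.
Qed.

End SkewPolynomials.

(** * Linearized Reed-Solomon points *)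

Section LinearizedReedSolomon.
Variables (F : finFieldType) (q h : nat) (w : F).
Hypothesis q_gt2 : (2 < q)%N.
Hypothesis h_gt0 : (0 < h)%N.
Hypothesis cardF : #|F| = (q ^ h)%N.
Hypothesis frobD : forall x y : F, (x + y) ^+ q = x ^+ q + y ^+ q.
Hypothesis prim_w : (q ^ h).-1.-primitive_root w.

Let q_gt1 : (1 < q)%N := ltnW q_gt2.
Let q_gt0 : (0 < q)%N := ltnW q_gt1.
Let K := [set x : F | x ^+ q == x].
(** The exponent (q^h - 1)/(q - 1) of the norm from [F] to its subfield [K]. *)
Let N := (\sum_(i < h) q ^ i)%N.

Let N_gt0 : (0 < N)%N.
Proof. by rewrite /N; case: h h_gt0 => // m _; rewrite big_ord_recl. Qed.

Let orderE : (q ^ h).-1 = (q.-1 * N)%N.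
Proof. exact: predn_exp. Qed.

Let w_neq0 : w != 0.
Proof.
apply/eqP=> w0; have := prim_expr_order prim_w; move/eqP; rewrite w0 expr0n.
by rewrite gtn_eqF ?(prim_order_gt0 prim_w) // eq_sym oner_eq0.
Qed.

Lemma expf_pred_card (x : F) : x != 0 -> x ^+ (q ^ h).-1 = 1.
Proof.
move=> x0; apply: (mulIf x0); rewrite -exprSr prednK ?expn_gt0 ?q_gt0 //.
by rewrite -cardF expf_card mul1r.
Qed.

Lemma prim_expM_inj i j : (i < q.-1)%N -> (j < q.-1)%N ->
  w ^+ (i * N) = w ^+ (j * N) -> i = j.
Proof.
move=> iq jq /eqP; rewrite (eq_prim_root_expr prim_w) orderE.
rewrite !modn_small ?ltn_pmul2r // => /eqP E.
by apply/eqP; rewrite -(eqn_pmul2r N_gt0); apply/eqP.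
Qed.

(** Raising to the power [N] removes [x ^+ q.-1], and [w ^+ N] has order [q.-1]. *)
Lemma prim_exp_nonconj i j (x : F) : (i < q.-1)%N -> (j < q.-1)%N ->
  x != 0 -> w ^+ i * x ^+ q.-1 = w ^+ j -> i = j.
Proof.
move=> iq jq x0 /(congr1 (fun z => z ^+ N)); rewrite exprMn -!exprM -orderE.
by rewrite expf_pred_card // mulr1; apply: prim_expM_inj.
Qed.

(** Zero and the [q.-1] powers of [w ^+ N] are distinct fixed points. *)
Lemma card_frob_fixed : (q <= #|K|)%N.
Proof.
have -> : q = #|0 |: [set w ^+ (i * N) | i : 'I_q.-1]|.
  rewrite cardsU1 card_imset ?card_ord.
    have -> : (0 \notin [set w ^+ (i * N) | i : 'I_q.-1]); last by rewrite add1n prednK.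
    by apply/imsetP=> -[i _ /esym/eqP]; rewrite expf_eq0 (negPf w_neq0) andbF.
  move=> i j /prim_expM_inj E; exact/val_inj/E.
apply: subset_leq_card; apply/subsetP=> x /setU1P[->|/imsetP[i _ ->]].
  by rewrite inE expr0n gtn_eqF.
rewrite inE; move: (nat_of_ord i) => k; rewrite -{1}(prednK q_gt0) exprS.
rewrite -[X in _ * X]exprM mulnAC -mulnA -orderE.
by rewrite [(k * _.-1)%N]mulnC [in X in _ * X]exprM (prim_expr_order prim_w) expr1n mulr1.
Qed.

Lemma frob_sum (I : finType) (f : I -> F) : (\sum_i f i) ^+ q = \sum_i f i ^+ q.
Proof.
by apply: (big_morph (fun x => x ^+ q)) => //; rewrite expr0n gtn_eqF.
Qed.

Lemma frob_fixedX x k : x \in K -> x ^+ (q ^ k) = x.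
Proof.
rewrite inE => /eqP xq; elim: k => [|k IHk]; first by rewrite expn0 expr1.
by rewrite expnSr exprM IHk.
Qed.

(* A dependency is a polynomial over the fixed field with the root [w], hence with the
   [h] distinct conjugates of [w] as roots. *)
Lemma prim_powers_free (m : nat -> F) : (forall k, m k \in K) ->
  \sum_(k < h) m k * w ^+ k = 0 -> forall k, (k < h)%N -> m k = 0.
Proof.
move=> mK m0; pose p := \poly_(k < h) m k.
have pE x : p.[x] = \sum_(k < h) m k * x ^+ k by rewrite horner_poly.
suff p0 : p = 0 by move=> k kh; have := coef_poly h m k; rewrite kh -/p p0 coef0.
apply: (@roots_geq_poly_eq0 _ _ [seq w ^+ (q ^ i) | i <- iota 0 h]).
- apply/allP=> _ /mapP[i _ ->]; rewrite rootE; elim: i => [|i /eqP IHi].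
    by rewrite expn0 expr1 pE m0.
  rewrite expnSr exprM; move: IHi; set x := _ ^+ (q ^ i) => x0.
  have <- : p.[x] ^+ q = p.[x ^+ q]; last by rewrite x0 expr0n gtn_eqF.
  rewrite !pE frob_sum; apply/eq_bigr=> k _; rewrite exprMn exprAC.
  by have := mK k; rewrite inE => /eqP->.
- rewrite map_inj_in_uniq ?iota_uniq // => i j; rewrite !mem_iota /= add0n => ih jh.
  (* These exponents stay below the order of [w], so the conjugates are distinct; [q > 2] covers the
     case [h = 1]. *)
  have small k : (k < h)%N -> (q ^ k < (q ^ h).-1)%N.
    move=> kh; have kh1 : (k <= h.-1)%N by rewrite -ltnS prednK.
    apply: (@leq_ltn_trans (q ^ h.-1)); first by rewrite leq_pexp2l.
    rewrite -[in X in (_ < X)%N](prednK h_gt0) expnS.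
    have : (0 < q ^ h.-1)%N by rewrite expn_gt0 q_gt0.
    move: q_gt2; nia.
  move=> /eqP; rewrite (eq_prim_root_expr prim_w) !modn_small ?small // => /eqP.
  exact: expnI.
- by rewrite size_map size_iota size_poly.
Qed.

Lemma frob_fixedB x y : x \in K -> y \in K -> x - y \in K.
Proof.
rewrite !inE => /eqP xK /eqP yK; apply/eqP/(@addIr _ y).
by rewrite subrK -{2}yK -frobD subrK.
Qed.

Lemma frob_fixedM x y : x \in K -> y \in K -> x * y \in K.
Proof. by rewrite !inE exprMn => /eqP-> /eqP->. Qed.

Lemma frob_fixed_sum (I : finType) (f : I -> F) :
  (forall i, f i \in K) -> \sum_i f i \in K.
Proof.
move=> fK; rewrite inE frob_sum; apply/eqP/eq_bigr=> i _.
by have := fK i; rewrite inE => /eqP.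
Qed.

Lemma frob_fixedXn x k : x \in K -> x ^+ k \in K.
Proof. by rewrite !inE exprAC => /eqP->. Qed.

Variables (r : nat) (alpha : 'I_r -> F).
Hypothesis alphaK : forall j, alpha j \in K.
Hypothesis alpha_inj : injective alpha.

(* The point (alpha_j, ..., alpha_j^h) of the moment curve, read in the basis
   1, w, ..., w^(h-1) of [F] over the fixed field. *)
Let beta j := \sum_(k < h) alpha j ^+ k.+1 * w ^+ k.

(** Comparing coordinates in the powers of [w] turns one relation in [F] into the vanishing of all
    moments up to order [h], hence of the sums for every polynomial of degree at most [h]. *)
Lemma beta_affine_free (T : {set 'I_r}) j0 (m : 'I_r -> F) :
    j0 \in T -> (#|T| <= h.+1)%N -> (forall j, m j \in K) ->
    (forall j, j \notin T :\ j0 -> m j = 0) ->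
    \sum_j m j * (beta j - beta j0) = 0 -> forall j, m j = 0.
Proof.
move=> Tj0 Th mK m0 sum0.
have moments k : (k <= h)%N -> \sum_j m j * (alpha j ^+ k - alpha j0 ^+ k) = 0.
  case: k => [_|k kh]; first by apply: big1 => j _; rewrite !expr0 subrr mulr0.
  apply: (prim_powers_free
    (m := fun k => \sum_j m j * (alpha j ^+ k.+1 - alpha j0 ^+ k.+1))) kh => [i|].
    by apply: frob_fixed_sum => j; rewrite frob_fixedM ?frob_fixedB ?frob_fixedXn.
  rewrite -[RHS]sum0; under eq_bigr => i _ do rewrite mulr_suml.
  rewrite exchange_big /=; apply: eq_bigr => j _.
  rewrite -sumrB mulr_sumr; apply: eq_bigr => i _; ring.
have polys (p : {poly F}) : (size p <= h.+1)%N -> \sum_j m j * (p.[alpha j] - p.[alpha j0]) = 0.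
  move=> ph; transitivity
      (\sum_(k < h.+1) p`_k * \sum_j m j * (alpha j ^+ k - alpha j0 ^+ k)); last first.
    by apply: big1 => k _; rewrite moments ?mulr0 // -ltnS.
  under [RHS]eq_bigr => k _ do rewrite mulr_sumr.
  rewrite exchange_big /=; apply: eq_bigr => j _.
  rewrite !(horner_coef_wide _ ph) -sumrB mulr_sumr; apply: eq_bigr => k _; ring.
move=> j; case: (boolP (j \in T :\ j0)) => [Tj|/m0//].
have [nj Tj'] : j != j0 /\ j \in T by apply/andP; rewrite -in_setD1.
(* This polynomial vanishes at every selected point, [alpha j0] included, except [alpha j], so it
   isolates [m j]. *)
pose p := \prod_(i in T :\ j) ('X - (alpha i)%:P).
have szp : (size p <= h.+1)%N.
  by rewrite /p -big_enum size_prod_XsubC -cardE; move: Th; rewrite (cardsD1 j) Tj'.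
have pz i : i \in T :\ j -> p.[alpha i] = 0.
  by move=> Ti; rewrite /p (bigD1 i) //= hornerM !hornerE subrr mul0r.
have := polys p szp; rewrite (pz j0); last by rewrite in_setD1 eq_sym nj.
rewrite (bigD1 j) //= big1 => [|i ni]; last first.
  case: (boolP (i \in T :\ j0)) => [Ti|/m0->]; last by rewrite mul0r.
  by rewrite pz ?subrr ?mulr0 // in_setD1 ni; move: Ti; rewrite in_setD1 => /andP[].
rewrite addr0 subr0 => /eqP; rewrite mulf_eq0 => /orP[/eqP//|].
rewrite /p horner_prod => /prodf_eq0 [i]; rewrite in_setD1 => /andP[ni _].
by rewrite !hornerE subr_eq0 => /eqP/alpha_inj ij; rewrite ij eqxx in ni.
Qed.

Variables (g : nat).
Hypothesis g_lt_q : (g < q)%N.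

Let c (i : 'I_g) := w ^+ i.
Let D (i : 'I_g) : 'M[F]_(h, r) := \matrix_(k, j) iter k (twist q (c i)) (beta j).

Lemma skew_eval_sum (e : F) n a (I : finType) (f : I -> F) :
  skew_eval q e n a (\sum_i f i) = \sum_i skew_eval q e n a (f i).
Proof.
apply: (big_morph (skew_eval q e n a)) => [x y|]; last exact: skew_eval0.
rewrite -[y in LHS]opprK -[- y]sub0r !(skew_evalB frobD).
by rewrite (skew_eval0 frobD) sub0r opprK.
Qed.

Lemma skew_evalZ (e : F) n a x z : x \in K ->
  skew_eval q e n a (x * z) = x * skew_eval q e n a z.
Proof.
move=> xK; rewrite /skew_eval mulr_sumr; apply: eq_bigr => k _.
by rewrite iter_twistM frob_fixedX // mulrCA.
Qed.

(** By linearity over [K], all combinations of the differences [beta j - beta j0] lie in the kernel,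
    and affine independence makes them distinct. *)
Lemma card_ker_ge (T : {set 'I_r}) (e z : F) n a :
    (0 < #|T|)%N -> (#|T| <= h.+1)%N ->
    (forall j, j \in T -> skew_eval q e n a (beta j) = z) ->
  (q ^ #|T|.-1 <= #|[set x | skew_eval q e n a x == 0%R]|)%N.
Proof.
move=> /card_gt0P[j0 Tj0] Th Tz.
pose P := pffun_on (0 : F) (T :\ j0) K.
pose f (m : {ffun 'I_r -> F}) := \sum_j m j * (beta j - beta j0).
have PK (m : {ffun 'I_r -> F}) : m \in P -> forall j, m j \in K.
  move=> /pffun_onP[/supportP m0 mK] j; case: (boolP (j \in T :\ j0)) => [Tj|/m0->].
    by apply: mK; exact: image_f.
  by rewrite inE expr0n gtn_eqF.
have P0 (m : {ffun 'I_r -> F}) : m \in P -> forall j, j \notin T :\ j0 -> m j = 0.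
  by move=> /pffun_onP[/supportP].
apply: (@leq_trans #|P|).
  rewrite card_pffun_on (cardsD1 j0 T) Tj0 add1n /=.
  by case: #|T :\ j0| => // k; rewrite leq_exp2r ?card_frob_fixed.
rewrite -(card_in_imset (f := f)) => [|m m' mP m'P ff].
  apply: subset_leq_card; apply/subsetP=> _ /imsetP[m mP ->]; rewrite inE skew_eval_sum.
  apply/eqP/big1=> j _; rewrite skew_evalZ ?PK // (skew_evalB frobD).
  case: (boolP (j \in T :\ j0)) => [|/(P0 _ mP)->]; last by rewrite mul0r.
  by rewrite in_setD1 => /andP[_ Tj]; rewrite !Tz // subrr mulr0.
apply/ffunP=> j; apply/eqP; rewrite -subr_eq0; apply/eqP; move: j.
apply: (beta_affine_free Tj0 Th) => [j|j Tj|].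
- by rewrite frob_fixedB ?PK.
- by rewrite !P0 ?subrr.
- under eq_bigr => j _ do rewrite mulrBl.
  by rewrite sumrB; apply/eqP; rewrite subr_eq0; apply/eqP.
Qed.

(** A nonzero [y] is read as a skew polynomial of degree below [h]; its kernels would have sizes
    with product at least [q ^ h], too many for its degree. *)
Lemma MR_LRC_linearized : (0 < g)%N -> (h + 2 <= r)%N -> (g + h < g * r)%N ->
  MR_LRC (fun=> const_mx 1 : 'M[F]_(1, r)) D.
Proof.
move=> g0 hr ltgr; apply: MR_LRC_const1 => // S e y S0 sS Sy.
apply/eqP; apply: contraT => y0.
have p0 : rVpoly y != 0 by apply: contra_neq y0 => E; rewrite -[y]rVpolyK E linear0.
set p := rVpoly y in p0; have ph : (size p <= h)%N by exact: size_poly.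
(* The root bound needs a nonzero top coefficient, so the skew polynomial is cut at the true degree
   of [p]. *)
have szp : (size p).-1.+1 = size p by rewrite prednK // lt0n size_poly_eq0.
have sS1 : (\sum_i #|S i|.-1 = h)%N.
  apply/eqP; rewrite -(eqn_add2l g) -sS -[X in (X + _)%N]card_ord -sum1_card -big_split /=.
  by apply/eqP/eq_bigr=> i _; rewrite add1n prednK.
have Sh i : (#|S i| <= h.+1)%N.
  by rewrite -(prednK (S0 i)) ltnS -sS1 (bigD1 i) //= leq_addr.
have Sev i j : j \in S i -> skew_eval q (c i) (size p).-1.+1 (fun k => p`_k) (beta j) = - e i.
  move=> Sj; apply/eqP; rewrite -addr_eq0 addrC; apply/eqP.
  rewrite -[RHS](Sy _ _ Sj) mxE szp; congr (_ + _).
  rewrite /skew_eval [LHS](big_ord_widen h (fun k => p`_k * iter k (twist q (c i)) (beta j)) ph).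
  rewrite big_mkcond; apply: eq_bigr => k _; rewrite mxE -coef_rVpoly_ord -/p.
  by case: ltnP => // /(nth_default 0)->; rewrite mul0r.
have : (q ^ h <= q ^ (size p).-1)%N.
  apply: leq_trans (prod_card_ker q_gt1 frobD (c := c) _ _ (a := fun k => p`_k) _).
  - rewrite -{1}sS1 expn_sum; apply: leq_prod => i _.
    exact: card_ker_ge (S0 i) (Sh i) (Sev i).
  - by move=> i; rewrite expf_neq0.
  - move=> i j x x0 E; apply: val_inj; apply: prim_exp_nonconj x0 E.
      by rewrite -ltnS prednK // (leq_ltn_trans (ltn_ord _) g_lt_q).
    by rewrite -ltnS prednK // (leq_ltn_trans (ltn_ord _) g_lt_q).
  - by rewrite -lead_coefE lead_coef_eq0.
by rewrite leq_exp2l // leqNgt szp ph.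
Qed.

End LinearizedReedSolomon.

(** * Choice of the field *)

Lemma exists_prim_root (F : finFieldType) :
  exists w : F, (#|F|).-1.-primitive_root w.
Proof.
have F1 : (1 < #|F|)%N by exact: finNzRing_gt1.
have cU : #|[set x : F | x != 0]| = #|F|.-1.
  by rewrite -(cardC1 (0 : F)); apply: eq_card => x; rewrite !inE.
have : has (#|F|.-1).-primitive_root (enum [set x : F | x != 0]).
  apply: has_prim_root; rewrite ?enum_uniq -?cardE ?cU //; first by rewrite -ltnS prednK // ltnW.
  apply/allP=> x; rewrite mem_enum inE => x0; rewrite unity_rootE.
  apply/eqP; apply: (mulIf x0).
  by rewrite mul1r -exprSr (prednK (ltnW F1)) expf_card.
by case/hasP=> w _ ?; exists w.
Qed.

(** With a single group, [c] and [y] form a polynomial of degree at most [h] with [h + 1] distinct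
    roots. *)
Lemma MR_LRC_vandermonde (F : finFieldType) h r (alpha : 'I_r -> F) :
    injective alpha -> (0 < h)%N -> (h + 2 <= r)%N -> (1 + h < 1 * r)%N ->
  MR_LRC (fun=> const_mx 1 : 'M[F]_(1, r))
    (fun _ : 'I_1 => \matrix_(k < h, j < r) alpha j ^+ k.+1).
Proof.
move=> alpha_inj h0 hr ltr; apply: MR_LRC_const1 => // S c y _.
rewrite big_ord1 add1n => cS Sy; pose p := (c ord0)%:P + 'X * rVpoly y.
have p0 : p = 0.
  apply: (@roots_geq_poly_eq0 _ _ [seq alpha j | j <- enum (S ord0)]).
  - apply/allP=> _ /mapP[j + ->]; rewrite mem_enum => Sj.
    rewrite rootE -(Sy ord0 j Sj) /p !hornerE; apply/eqP; congr (_ + _).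
    rewrite horner_poly mxE mulr_sumr; apply: eq_bigr => k _.
    by rewrite -/(rVpoly y) mxE exprS valK; ring.
  - by rewrite map_inj_uniq ?enum_uniq.
  - rewrite size_map -cardE cS; apply: leq_trans (size_polyD _ _) _.
    rewrite geq_max (leq_trans (size_polyC_leq1 _)) //=.
    rewrite (leq_trans (size_polyMleq _ _)) // size_polyX /= ltnS; exact: size_poly.
apply/rowP=> k; have : p`_k.+1 = 0 by rewrite p0 coef0.
by rewrite /p coefD coefC coefXM /= add0r coef_rVpoly_ord mxE.
Qed.

Lemma frobenius_pow2 (F : finFieldType) t (x y : F) : 2 \in [pchar F] ->
  (x + y) ^+ (2 ^ t) = x ^+ (2 ^ t) + y ^+ (2 ^ t).
Proof. by move=> F2; apply: exprDn_pchar; rewrite pnatX pnatE // F2. Qed.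

(* Õ(n/r) = Õ(g) is rendered as C * g * (1 + log2 g)^K for absolute constants C, K. *)
Theorem theorem3p9 :
  exists C K : nat,
  forall r h g : nat,
    (0 < r)%N -> (0 < h)%N -> (0 < g)%N ->
    (h + 2 <= r)%N -> (g + h < g * r)%N ->
    exists l : nat,
      (l <= (maxn (C * g * (trunc_log 2 g).+1 ^ K) ((2 * r) ^ (h + 1)./2))
              ^ (minn h g))%N /\
      exists_MR_LRC l g r h 1.
Proof.
(* No logarithm arises: if [r <= g], then [q] is at most 2(g + 1), hence at most 4g. *)
exists 4, 0 => r h g r0 h0 g0 hr ltgr.
set M := maxn _ _.
(* [g < q] gives [g] nonconjugate powers of [w], and [r <= q] gives [r] distinct values [alpha j] in
   the fixed field. *)
pose m := maxn g.+1 r; pose t := up_log 2 m; pose q := (2 ^ t)%N.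
have m_gt2 : (2 < m)%N by rewrite /m; lia.
have /andP[lt_m le_m] : (2 ^ t.-1 < m <= q)%N by apply: up_log_bounds; rewrite // ltnW.
have t_gt0 : (0 < t)%N by rewrite up_log_gt0 /= ltnW.
have q_gt2 : (2 < q)%N by exact: leq_trans le_m.
have q_lt : (q < 2 * m)%N by rewrite /q -(prednK t_gt0) expnS ltn_pmul2l.
have g_lt_q : (g < q)%N by apply: leq_trans le_m; rewrite leq_maxl.
have r_le_q : (r <= q)%N by apply: leq_trans le_m; rewrite leq_maxr.
have h2_gt0 : (0 < (h + 1)./2)%N by case: (h) h0 => // h' _; rewrite addn1.
have r2_gt0 : (0 < 2 * r)%N by rewrite muln_gt0.
have q_le_M : (q <= M)%N.
  rewrite /M leq_max expn0 muln1; case: (leqP g.+1 r) => gr.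
    apply/orP; right; apply: (@leq_trans ((2 * r) ^ 1)); last by rewrite leq_pexp2l.
    by rewrite expn1 (leq_trans (ltnW q_lt)) // leq_mul2l geq_max gr leqnn.
  apply/orP; left; rewrite (leq_trans (ltnW q_lt)) // -[4]/(2 * 2)%N -mulnA leq_mul2l.
  by rewrite geq_max (leq_trans (ltnW gr)) ?ltn_Pmull.
(* For [g = 1] the exponent [minn h g] is 1, and a field of size [q ^ h] need not fit. *)
have [g1|g_neq1] := eqVneq g 1%N.
  have [F F2 cF] := pPrimePowerField (isT : prime 2) t_gt0.
  exists q; split; first by rewrite g1 (minn_idPr h0) expn1.
  exists F; split=> //; rewrite g1 in ltgr *.
  have rF : (r <= #|F|)%N by rewrite cF.
  exists (fun=> const_mx 1), (fun=> \matrix_(k, j) (enum_val (widen_ord rF j) : F) ^+ k.+1).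
  apply: (MR_LRC_vandermonde (alpha := fun j => enum_val (widen_ord rF j))) => // i j.
  by move=> /enum_val_inj /(congr1 val) /= /val_inj.
have th_gt0 : (0 < t * h)%N by rewrite muln_gt0 t_gt0.
have [F F2 cF] := pPrimePowerField (isT : prime 2) th_gt0.
have {}cF : #|F| = (q ^ h)%N by rewrite cF expnM.
have [w] := exists_prim_root F; rewrite cF => prim_w.
exists (q ^ h)%N; split.
  case: (leqP h g) => hg; first by rewrite leq_exp2r.
  have gr : (g.+1 <= r)%N by apply: leq_trans hg (leq_trans _ hr); rewrite leq_addr.
  apply: (@leq_trans ((2 * r) ^ h)).
    by rewrite leq_exp2r // (leq_trans (ltnW q_lt)) // leq_mul2l geq_max gr leqnn.
  apply: (@leq_trans (((2 * r) ^ (h + 1)./2) ^ g)); last by rewrite leq_exp2r // leq_maxr.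
  rewrite -expnM leq_pexp2l //.
  have g2 : (2 <= g)%N by lia.
  (* Since [g >= 2], it suffices that [h] is at most twice [(h + 1)./2]. *)
  apply: (@leq_trans ((h + 1)./2 * 2)); last by rewrite leq_mul2l g2 orbT.
  lia.
exists F; split=> //.
have frobD (x y : F) : (x + y) ^+ q = x ^+ q + y ^+ q by exact: frobenius_pow2.
have rK := leq_trans r_le_q (card_frob_fixed q_gt2 h0 prim_w).
pose alpha (j : 'I_r) : F := enum_val (widen_ord rK j).
eexists; eexists.
apply: (MR_LRC_linearized q_gt2 h0 cF frobD prim_w (alpha := alpha) _ _ g_lt_q) => //.
  by move=> j; exact: enum_valP.
by move=> i j /enum_val_inj /(congr1 val) /= /val_inj.
Qed.
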